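(* Let $c\in\mathbb R$, $c\neq0$, and $s_0=\frac12\left(c^2+\sqrt{c^4+16}\right)$. For all $A\geq 0$ small enough, the Hamiltonian system defined in the context (with parameter $A$) has a unique periodic circular orbit with $P_\theta=c$. This orbit is given by $$s=s(A)=s_0+\mathcal O(A^2),\qquad d=d(A)=d'(0)\,A+\mathcal O(A^2),\qquad P_\theta=c,\qquad P_r=P_x=0,$$ where $s(A)$ and $d(A)$ are differentiable functions of $A$ near $A=0$ with $s(0)=s_0$, $d(0)=0$.
   Context: For a parameter $A\in[0,1/3]$, consider on $\{r>0\}$, with coordinates $(r,\theta,x,P_r,P_\theta,P_x)$ ($r>0$ the distance to the $x$-axis, $\theta$ the polar angle around it), the Hamiltonian $$\mathcal H=\frac12\left(P_r^2+P_x^2+\frac{P_\theta^2}{r^2}\right)+3A\,d-\frac14(3A\,d\,s+4)\ln\left(\frac{s+2}{s-2}\right),$$ where $$s=\sqrt{(A+x-1)^2+r^2}+\sqrt{(A+x+1)^2+r^2},\qquad d=\sqrt{(A+x-1)^2+r^2}-\sqrt{(A+x+1)^2+r^2}.$$ Its equations of motion are $$\dot r=P_r,\quad \dot\theta=\frac{P_\theta}{r^2},\quad \dot x=P_x,\quad \dot P_\theta=0,$$ $$\dot P_r=\frac{P_\theta^2}{r^3}-\frac{16r(3Ad+s)}{(s^2-d^2)(s^2-4)},\qquad \dot P_x=\frac{4d+12As}{s^2-d^2}-3A\ln\left(\frac{s+2}{s-2}\right).$$ The pair $(r,x)$ with $r>0$ is recovered from $(s,d)\in(2,\infty)\times(-2,2)$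 by $r=\frac14\sqrt{(s^2-4)(4-d^2)}$, $x=-A-\frac{ds}{4}$. A circular orbit is a solution with $r$ and $x$ constant in time (hence $P_r=P_x=0$ and $s,d$ constant); orbits differing only in the initial value of $\theta$ are identified. *)

(* Defs.v *)
From Stdlib Require Import Reals Lra.
From Coquelicot Require Import Coquelicot.
Open Scope R_scope.

Definition rho1 (A r x : R) : R := sqrt ((A + x - 1) ^ 2 + r ^ 2).
Definition rho2 (A r x : R) : R := sqrt ((A + x + 1) ^ 2 + r ^ 2).
Definition s_coord (A r x : R) : R := rho1 A r x + rho2 A r x.
Definition d_coord (A r x : R) : R := rho1 A r x - rho2 A r x.

Definition log_term (A r x : R) : R :=
  ln ((s_coord A r x + 2) / (s_coord A r x - 2)).

Definition hamiltonian (A r theta x pr ptheta px : R) : R :=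
  1 / 2 * (pr ^ 2 + px ^ 2 + ptheta ^ 2 / r ^ 2)
  + 3 * A * d_coord A r x
  - 1 / 4 * (3 * A * d_coord A r x * s_coord A r x + 4) * log_term A r x.

(* q_theta is a real lift of the polar angle. *)
Record phase : Type := Phase {
  q_r : R; q_theta : R; q_x : R; p_r : R; p_theta : R; p_x : R }.

(* [Derive] is total; on r > 0 the Hamiltonian is differentiable and the lemmas
   dH_drE, ..., dH_dpthetaE below compute these partial derivatives. *)
Definition dH_dr (A : R) (z : phase) : R :=
  Derive (fun v => hamiltonian A v (q_theta z) (q_x z) (p_r z) (p_theta z) (p_x z)) (q_r z).
Definition dH_dtheta (A : R) (z : phase) : R :=
  Derive (fun v => hamiltonian A (q_r z) v (q_x z) (p_r z) (p_theta z) (p_x z)) (q_theta z).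
Definition dH_dx (A : R) (z : phase) : R :=
  Derive (fun v => hamiltonian A (q_r z) (q_theta z) v (p_r z) (p_theta z) (p_x z)) (q_x z).
Definition dH_dpr (A : R) (z : phase) : R :=
  Derive (fun v => hamiltonian A (q_r z) (q_theta z) (q_x z) v (p_theta z) (p_x z)) (p_r z).
Definition dH_dptheta (A : R) (z : phase) : R :=
  Derive (fun v => hamiltonian A (q_r z) (q_theta z) (q_x z) (p_r z) v (p_x z)) (p_theta z).
Definition dH_dpx (A : R) (z : phase) : R :=
  Derive (fun v => hamiltonian A (q_r z) (q_theta z) (q_x z) (p_r z) (p_theta z) v) (p_x z).

Definition is_solution (A : R) (g : R -> phase) : Prop :=
  forall t : R,
    0 < q_r (g t) /\
    is_derive (fun u => q_r (g u)) t (dH_dpr A (g t)) /\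
    is_derive (fun u => q_theta (g u)) t (dH_dptheta A (g t)) /\
    is_derive (fun u => q_x (g u)) t (dH_dpx A (g t)) /\
    is_derive (fun u => p_r (g u)) t (- dH_dr A (g t)) /\
    is_derive (fun u => p_theta (g u)) t (- dH_dtheta A (g t)) /\
    is_derive (fun u => p_x (g u)) t (- dH_dx A (g t)).

Definition is_circular (g : R -> phase) : Prop :=
  forall t u : R, q_r (g t) = q_r (g u) /\ q_x (g t) = q_x (g u).

(* Periodicity in phase space, where theta is an angle modulo 2 PI. *)
Definition is_periodic (g : R -> phase) : Prop :=
  exists T : R, 0 < T /\
    forall t : R,
      q_r (g (t + T)) = q_r (g t) /\
      (exists k : Z, q_theta (g (t + T)) = q_theta (g t) + 2 * PI * IZR k) /\
      q_x (g (t + T)) = q_x (g t) /\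
      p_r (g (t + T)) = p_r (g t) /\
      p_theta (g (t + T)) = p_theta (g t) /\
      p_x (g (t + T)) = p_x (g t).

Definition is_periodic_circular_orbit (A c : R) (g : R -> phase) : Prop :=
  is_solution A g /\ is_circular g /\ is_periodic g /\
  forall t : R, p_theta (g t) = c.

(* The two solutions differ only in the initial value of theta. *)
Definition same_orbit (g h : R -> phase) : Prop :=
  exists theta0 : R, forall t : R,
    q_r (h t) = q_r (g t) /\
    q_theta (h t) = q_theta (g t) + theta0 /\
    q_x (h t) = q_x (g t) /\
    p_r (h t) = p_r (g t) /\
    p_theta (h t) = p_theta (g t) /\
    p_x (h t) = p_x (g t).

(* f(A) = O(A^2) as A -> 0 *)
Definition is_O_sq (f : R -> R) : Prop :=
  exists K delta : R, 0 < delta /\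
    forall A : R, Rabs A < delta -> Rabs (f A) <= K * A ^ 2.

Lemma norm2_gt0 (a r : R) : 0 < r -> 0 < a ^ 2 + r ^ 2.
Proof. intro Hr; assert (0 <= a ^ 2) by apply pow2_ge_0; nra. Qed.

Lemma rho1_sq (A r x : R) : 0 < r -> rho1 A r x ^ 2 = (A + x - 1) ^ 2 + r ^ 2.
Proof. intro Hr; apply pow2_sqrt, Rlt_le, norm2_gt0, Hr. Qed.

Lemma rho2_sq (A r x : R) : 0 < r -> rho2 A r x ^ 2 = (A + x + 1) ^ 2 + r ^ 2.
Proof. intro Hr; apply pow2_sqrt, Rlt_le, norm2_gt0, Hr. Qed.

Lemma rho1_gt0 (A r x : R) : 0 < r -> 0 < rho1 A r x.
Proof. intro Hr; apply sqrt_lt_R0, norm2_gt0, Hr. Qed.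

Lemma rho2_gt0 (A r x : R) : 0 < r -> 0 < rho2 A r x.
Proof. intro Hr; apply sqrt_lt_R0, norm2_gt0, Hr. Qed.

Lemma s_coord_gt2 (A r x : R) : 0 < r -> 2 < s_coord A r x.
Proof.
intro Hr; unfold s_coord.
pose proof (rho1_gt0 A r x Hr); pose proof (rho2_gt0 A r x Hr).
pose proof (rho1_sq A r x Hr); pose proof (rho2_sq A r x Hr).
assert (1 - (A + x) < rho1 A r x) by nra.
assert (1 + (A + x) < rho2 A r x) by nra.
lra.
Qed.

Lemma is_derive_rho1_r (A r x : R) :
  0 < r -> is_derive (fun v => rho1 A v x) r (r / rho1 A r x).
Proof.
intro Hr; pose proof (rho1_gt0 A r x Hr); pose proof (norm2_gt0 (A + x - 1) r Hr).
unfold rho1 in *; auto_derive; [simpl in *; lra|].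
replace (sqrt _) with (sqrt ((A + x - 1) ^ 2 + r ^ 2)) by (f_equal; ring).
field; lra.
Qed.

Lemma is_derive_rho2_r (A r x : R) :
  0 < r -> is_derive (fun v => rho2 A v x) r (r / rho2 A r x).
Proof.
intro Hr; pose proof (rho2_gt0 A r x Hr); pose proof (norm2_gt0 (A + x + 1) r Hr).
unfold rho2 in *; auto_derive; [simpl in *; lra|].
replace (sqrt _) with (sqrt ((A + x + 1) ^ 2 + r ^ 2)) by (f_equal; ring).
field; lra.
Qed.

Lemma is_derive_rho1_x (A r x : R) :
  0 < r -> is_derive (fun v => rho1 A r v) x ((A + x - 1) / rho1 A r x).
Proof.
intro Hr; pose proof (rho1_gt0 A r x Hr); pose proof (norm2_gt0 (A + x - 1) r Hr).
unfold rho1 in *; auto_derive; [simpl in *; lra|].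
replace (sqrt _) with (sqrt ((A + x - 1) ^ 2 + r ^ 2)) by (f_equal; ring).
field; lra.
Qed.

Lemma is_derive_rho2_x (A r x : R) :
  0 < r -> is_derive (fun v => rho2 A r v) x ((A + x + 1) / rho2 A r x).
Proof.
intro Hr; pose proof (rho2_gt0 A r x Hr); pose proof (norm2_gt0 (A + x + 1) r Hr).
unfold rho2 in *; auto_derive; [simpl in *; lra|].
replace (sqrt _) with (sqrt ((A + x + 1) ^ 2 + r ^ 2)) by (f_equal; ring).
field; lra.
Qed.

Lemma is_derive_potential (A : R) (f g : R -> R) (v df dg : R) :
  is_derive f v df -> is_derive g v dg -> 2 < f v + g v ->
  is_derive (fun u => 3 * A * (f u - g u)
     - 1 / 4 * (3 * A * (f u - g u) * (f u + g u) + 4)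
       * ln ((f u + g u + 2) / (f u + g u - 2))) v
    (3 * A * (df - dg)
     - 3 / 2 * A * (f v * df - g v * dg)
       * ln ((f v + g v + 2) / (f v + g v - 2))
     + (3 * A * (f v - g v) * (f v + g v) + 4) * (df + dg)
       / ((f v + g v) ^ 2 - 4)).
Proof.
intros Hf Hg Hs.
assert (Hq : 0 < (f v + g v + 2) / (f v + g v - 2))
  by (apply Rdiv_lt_0_compat; lra).
auto_derive.
- repeat split; try (exists df; exact Hf); try (exists dg; exact Hg); try lra.
  exact Hq.
- change (fun x => f x) with f. change (fun x => g x) with g.
  rewrite (is_derive_unique _ _ _ Hf), (is_derive_unique _ _ _ Hg).
  replace (f v + g v + - (2)) with (f v + g v - 2) by ring.
  fold ((f v + g v + 2) / (f v + g v - 2)).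
  generalize (ln ((f v + g v + 2) / (f v + g v - 2))); intro L.
  field. repeat split; nra.
Qed.

Lemma is_derive_hamiltonian_r (A r th x a b e : R) : 0 < r ->
  let s := s_coord A r x in
  let d := d_coord A r x in
  is_derive (fun v => hamiltonian A v th x a b e) r
    (- (b ^ 2 / r ^ 3
        - 16 * r * (3 * A * d + s) / ((s ^ 2 - d ^ 2) * (s ^ 2 - 4)))).
Proof.
intros Hr s d.
pose proof (rho1_gt0 A r x Hr) as Hp; pose proof (rho2_gt0 A r x Hr) as Hq.
pose proof (s_coord_gt2 A r x Hr) as Hs; unfold s_coord in Hs.
pose proof (is_derive_potential A _ _ r _ _
  (is_derive_rho1_r A r x Hr) (is_derive_rho2_r A r x Hr) Hs) as HV.
assert (HK : is_derive (fun v : R => 1 / 2 * (a ^ 2 + e ^ 2 + b ^ 2 / v ^ 2)) r (- (b ^ 2 / r ^ 3))).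
{ auto_derive; [nra|field; lra]. }
pose proof (is_derive_plus _ _ _ _ _ HK HV) as HT.
refine (is_derive_ext _ _ _ _ _ (eq_ind _ (is_derive _ _) HT _ _)).
- intro v; unfold hamiltonian, log_term, s_coord, d_coord, plus; simpl; ring.
- unfold s, d, s_coord, d_coord; clear HT HV HK s d; cbv beta.
  match goal with |- plus ?u ?v = ?w => change (@eq R (u + v) w) end.
  generalize dependent (rho1 A r x); intros p Hp.
  generalize dependent (rho2 A r x); intros q Hq Hs.
  generalize (ln ((p + q + 2) / (p + q - 2))); intro L.
  field; repeat split; try nra.
Qed.

Lemma is_derive_hamiltonian_x (A r th x a b e : R) : 0 < r ->
  let s := s_coord A r x in
  let d := d_coord A r x in
  is_derive (fun v => hamiltonian A r th v a b e) x
    (- ((4 * d + 12 * A * s) / (s ^ 2 - d ^ 2)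
        - 3 * A * ln ((s + 2) / (s - 2)))).
Proof.
intros Hr s d.
pose proof (rho1_gt0 A r x Hr) as Hp; pose proof (rho2_gt0 A r x Hr) as Hq.
pose proof (rho1_sq A r x Hr) as Hp2; pose proof (rho2_sq A r x Hr) as Hq2.
pose proof (s_coord_gt2 A r x Hr) as Hs; unfold s_coord in Hs.
pose proof (is_derive_potential A _ _ x _ _
  (is_derive_rho1_x A r x Hr) (is_derive_rho2_x A r x Hr) Hs) as HV.
assert (HK : is_derive (fun v : R => 1 / 2 * (a ^ 2 + e ^ 2 + b ^ 2 / r ^ 2)) x (0)).
{ auto_derive; [exact I|ring]. }
pose proof (is_derive_plus _ _ _ _ _ HK HV) as HT.
refine (is_derive_ext _ _ _ _ _ (eq_ind _ (is_derive _ _) HT _ _)).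
- intro v; unfold hamiltonian, log_term, s_coord, d_coord, plus; simpl; ring.
- unfold s, d, s_coord, d_coord; clear HT HV HK s d; cbv beta.
  match goal with |- plus ?u ?v = ?w => change (@eq R (u + v) w) end.
  generalize dependent (rho1 A r x); intros p Hp Hp2.
  generalize dependent (rho2 A r x); intros q Hq Hq2 Hs.
  generalize (ln ((p + q + 2) / (p + q - 2))); intro L.
  assert (Hx : x = (q ^ 2 - p ^ 2) / 4 - A) by lra.
  rewrite Hx.
  field; repeat split; try nra.
Qed.

Lemma dH_drE (A : R) (z : phase) : 0 < q_r z ->
  let s := s_coord A (q_r z) (q_x z) in
  let d := d_coord A (q_r z) (q_x z) in
  - dH_dr A z = p_theta z ^ 2 / q_r z ^ 3
    - 16 * q_r z * (3 * A * d + s) / ((s ^ 2 - d ^ 2) * (s ^ 2 - 4)).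
Proof.
intros Hr s d; unfold dH_dr.
erewrite is_derive_unique; [|apply is_derive_hamiltonian_r, Hr].
apply Ropp_involutive.
Qed.

Lemma dH_dxE (A : R) (z : phase) : 0 < q_r z ->
  let s := s_coord A (q_r z) (q_x z) in
  let d := d_coord A (q_r z) (q_x z) in
  - dH_dx A z = (4 * d + 12 * A * s) / (s ^ 2 - d ^ 2)
    - 3 * A * ln ((s + 2) / (s - 2)).
Proof.
intros Hr s d; unfold dH_dx.
erewrite is_derive_unique; [|apply is_derive_hamiltonian_x, Hr].
apply Ropp_involutive.
Qed.

Lemma dH_dthetaE (A : R) (z : phase) : dH_dtheta A z = 0.
Proof. unfold dH_dtheta, hamiltonian; apply Derive_const. Qed.

Lemma dH_dprE (A : R) (z : phase) : dH_dpr A z = p_r z.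
Proof.
unfold dH_dpr, hamiltonian; apply is_derive_unique; auto_derive; [exact I|field].
Qed.

Lemma dH_dpxE (A : R) (z : phase) : dH_dpx A z = p_x z.
Proof.
unfold dH_dpx, hamiltonian; apply is_derive_unique; auto_derive; [exact I|field].
Qed.

Lemma dH_dpthetaE (A : R) (z : phase) : 0 < q_r z ->
  dH_dptheta A z = p_theta z / q_r z ^ 2.
Proof.
intro Hr; unfold dH_dptheta, hamiltonian; apply is_derive_unique.
auto_derive; [exact I|field; lra].
Qed.

(* Main.v *)
Require Import Defs.
From Stdlib Require Import Reals Lra IndefiniteDescription.
From Coquelicot Require Import Coquelicot.
Open Scope R_scope.

(** On a circular orbit the two force equations become, in the coordinates
    [s], [d], a polynomial equation [radial_eq] and an equation [axial_eq] that
    is quadratic in [d].  The root of the latter that stays bounded as [A -> 0]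
    is [d = A * slope A s], and substituting it leaves one scalar equation
    [reduced c A s = 0], which at [A = 0] is [s^2 - 4 = c^2 s] with a simple root
    [s0]; the implicit function theorem continues this root.  Global uniqueness
    and [s = s0 + O(A^2)] follow from a priori bounds: the radial equation keeps
    [s] away from [2], then the axial equation, with
    [4 / s <= ln ((s + 2) / (s - 2)) <= 4 s / (s^2 - 4)], forces [d = O(A)], and
    the radial equation in turn forces [s - s0 = O(A^2)]. *)

(** * Implicit functions in the plane *)

Lemma differentiable_pt_lim_is_derive_1 (f : R -> R -> R) (x y lx ly : R) :
  differentiable_pt_lim f x y lx ly -> is_derive (fun u => f u y) x lx.
Proof.
intro Hf; apply is_derive_Reals.
replace lx with (lx * 1 + ly * 0) by ring.
apply (derivable_pt_lim_comp_2d f (fun u => u) (fun _ => y)); [exact Hf| |].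
- apply derivable_pt_lim_id.
- apply derivable_pt_lim_const.
Qed.

Lemma differentiable_pt_lim_is_derive_2 (f : R -> R -> R) (x y lx ly : R) :
  differentiable_pt_lim f x y lx ly -> is_derive (fun v => f x v) y ly.
Proof.
intro Hf; apply is_derive_Reals.
replace ly with (lx * 0 + ly * 1) by ring.
apply (derivable_pt_lim_comp_2d f (fun _ => x) (fun v => v)); [exact Hf| |].
- apply derivable_pt_lim_const.
- apply derivable_pt_lim_id.
Qed.

Lemma is_derive_continuity_pt (f : R -> R) (x l : R) :
  is_derive f x l -> continuity_pt f x.
Proof.
intro Hf; apply continuity_pt_filterlim, (@ex_derive_continuous R_AbsRing R_NormedModule).
exists l; exact Hf.
Qed.

Lemma continuity_pt_eps (f : R -> R) (x eps : R) : continuity_pt f x -> 0 < eps ->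
  exists delta, 0 < delta /\ forall u, Rabs (u - x) < delta -> Rabs (f u - f x) < eps.
Proof.
intros Hf He.
destruct (proj1 (continuity_pt_locally f x) Hf (mkposreal eps He)) as [delta Hd].
exists delta; split; [apply cond_pos|intros u Hu; exact (Hd u Hu)].
Qed.

(** Writing [k] for the increment of [sigma], differentiability of [F] bounds [lx * h + ly * k] by
    [e * max(|h|, |k|)]. For [e <= ly / 2] the [k] on the right is absorbed on the left, so
    [k = O(h)]; the bound then becomes [o(h)], which is the claimed derivative. *)
Lemma is_derive_implicit (F : R -> R -> R) (sigma : R -> R) (x lx ly : R) :
  differentiable_pt_lim F x (sigma x) lx ly -> 0 < ly ->
  continuity_pt sigma x ->
  (exists a, 0 < a /\ forall u, Rabs (u - x) < a -> F u (sigma u) = 0) ->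
  is_derive sigma x (- lx / ly).
Proof.
intros HF Hly Hsig [a [Ha Hzero]].
apply is_derive_Reals; intros eps Heps.
set (C := 1 + 2 * (Rabs lx + ly) / ly).
assert (HC : 1 <= C).
{ unfold C; assert (0 <= 2 * (Rabs lx + ly) / ly); [|lra].
  apply Rdiv_le_0_compat; [|exact Hly]; pose proof (Rabs_pos lx); lra. }
(* The first bound on [e] yields [|k| <= C * |h|]; the second makes the final error [e * C / ly] at
   most [eps / 2]. *)
set (e := Rmin (ly / 2) (eps * ly / (2 * C))).
assert (He : 0 < e).
{ unfold e; apply Rmin_glb_lt; [lra|].
  apply Rdiv_lt_0_compat; [apply Rmult_lt_0_compat; lra|lra]. }
assert (He1 : e <= ly / 2) by apply Rmin_l.
assert (He2 : e * C <= eps * ly / 2).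
{ apply Rle_trans with (eps * ly / (2 * C) * C).
  - apply Rmult_le_compat_r; [lra|apply Rmin_r].
  - right; field; lra. }
destruct (HF (mkposreal e He)) as [d1 Hd1]; simpl in Hd1.
destruct (continuity_pt_eps sigma x d1 Hsig (cond_pos d1)) as [d2 [Hd2 Hc]].
assert (Hd : 0 < Rmin a (Rmin d1 d2)).
{ repeat apply Rmin_glb_lt; try assumption; apply cond_pos. }
exists (mkposreal _ Hd); simpl; intros h Hh0 Hh.
assert (Hh1 : Rabs h < a) by (eapply Rlt_le_trans; [exact Hh|apply Rmin_l]).
assert (Hh' : Rabs h < Rmin d1 d2) by (eapply Rlt_le_trans; [exact Hh|apply Rmin_r]).
assert (Hh2 : Rabs h < d1) by (eapply Rlt_le_trans; [exact Hh'|apply Rmin_l]).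
assert (Hh3 : Rabs h < d2) by (eapply Rlt_le_trans; [exact Hh'|apply Rmin_r]).
assert (Ex : x + h - x = h) by ring.
set (k := sigma (x + h) - sigma x).
assert (Hk : Rabs k < d1) by (apply Hc; rewrite Ex; exact Hh3).
assert (B : Rabs (lx * h + ly * k) <= e * Rmax (Rabs h) (Rabs k)).
{ specialize (Hd1 (x + h) (sigma (x + h))); rewrite Ex in Hd1.
  specialize (Hd1 Hh2 Hk).
  rewrite (Hzero (x + h)) in Hd1 by (rewrite Ex; exact Hh1).
  rewrite (Hzero x) in Hd1 by (rewrite Rminus_diag, Rabs_R0; exact Ha).
  fold k in Hd1.
  replace (0 - 0 - (lx * h + ly * k)) with (- (lx * h + ly * k)) in Hd1 by ring.
  rewrite Rabs_Ropp in Hd1; exact Hd1. }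
pose proof (Rabs_pos_lt h Hh0) as Hhp.
pose proof (Rabs_pos k) as Hkp.
assert (Hkh : Rabs k <= C * Rabs h).
{ assert (B1 : ly * Rabs k <= Rabs (lx * h + ly * k) + Rabs lx * Rabs h).
  { rewrite <- (Rabs_pos_eq ly) at 1 by lra.
    rewrite <- !Rabs_mult.
    replace (ly * k) with ((lx * h + ly * k) + - (lx * h)) at 1 by ring.
    eapply Rle_trans; [apply Rabs_triang|rewrite Rabs_Ropp; lra]. }
  assert (B2 : e * Rmax (Rabs h) (Rabs k) <= ly / 2 * (Rabs h + Rabs k)).
  { apply Rmult_le_compat; try lra.
    - apply Rle_trans with (Rabs h); [lra|apply Rmax_l].
    - apply Rmax_lub; lra. }
  apply Rmult_le_reg_l with ly; [exact Hly|].
  replace (ly * (C * Rabs h)) with (ly * Rabs h + 2 * (Rabs lx + ly) * Rabs h)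
    by (unfold C; field; lra).
  pose proof (Rmult_le_pos ly (Rabs h)); nra. }
replace (k / h - - lx / ly) with ((lx * h + ly * k) / (ly * h)) by (field; lra).
unfold Rdiv; rewrite Rabs_mult, Rabs_inv, Rabs_mult, (Rabs_pos_eq ly) by lra.
apply Rmult_lt_reg_r with (ly * Rabs h); [apply Rmult_lt_0_compat; lra|].
rewrite Rmult_assoc, Rinv_l, Rmult_1_r
  by (apply Rgt_not_eq, Rmult_lt_0_compat; lra).
assert (B3 : Rmax (Rabs h) (Rabs k) <= C * Rabs h).
{ apply Rmax_lub; [|exact Hkh].
  rewrite <- (Rmult_1_l (Rabs h)) at 1; apply Rmult_le_compat_r; lra. }
apply Rle_lt_trans with (e * (C * Rabs h)).
{ eapply Rle_trans; [exact B|apply Rmult_le_compat_l; lra]. }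
assert (0 < eps * ly) by (apply Rmult_lt_0_compat; lra).
nra.
Qed.

(** Continuity of [Fy] at the centre keeps [Fy >= m > 0] on a smaller box, so each [F x] grows there
    with slope at least [m]. A sign change then gives a zero, and the slope bound gives its
    uniqueness and its continuity in [x]. Uniqueness holds in the whole window of width [b], and
    [sigma] is differentiable near [x0], not only at it. *)
Lemma implicit_function (F Fx Fy : R -> R -> R) (x0 y0 r : R) :
  0 < r ->
  (forall x y, Rabs (x - x0) < r -> Rabs (y - y0) < r ->
     differentiable_pt_lim F x y (Fx x y) (Fy x y)) ->
  continuity_2d_pt Fy x0 y0 -> F x0 y0 = 0 -> 0 < Fy x0 y0 ->
  exists (sigma : R -> R) (a b : R),
    0 < a <= r /\ 0 < b <= r /\ sigma x0 = y0 /\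
    forall x, Rabs (x - x0) < a ->
      Rabs (sigma x - y0) < b /\ F x (sigma x) = 0 /\ ex_derive sigma x /\
      (forall y, Rabs (y - y0) < b -> F x y = 0 -> y = sigma x).
Proof.
intros Hr HF HFy H0 Hpos.
set (m := Fy x0 y0 / 2); assert (Hm : 0 < m) by (unfold m; lra).
destruct (HFy (mkposreal m Hm)) as [d1 Hd1]; simpl in Hd1.
set (b := Rmin r d1).
assert (Hb : 0 < b) by (apply Rmin_glb_lt; [exact Hr|apply cond_pos]).
assert (Hbr : b <= r) by apply Rmin_l.
assert (Hbd : b <= d1) by apply Rmin_r.
assert (Hlow : forall x y, Rabs (x - x0) < b -> Rabs (y - y0) < b -> m <= Fy x y).
{ intros x y Hx Hy.
  assert (HH : Rabs (Fy x y - Fy x0 y0) < m) by (apply Hd1; lra).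
  apply Rabs_lt_between in HH; unfold m in *; lra. }
assert (HFb : forall x y, Rabs (x - x0) < b -> Rabs (y - y0) < b ->
          differentiable_pt_lim F x y (Fx x y) (Fy x y)) by (intros; apply HF; lra).
assert (Hinc : forall x y z, Rabs (x - x0) < b -> Rabs (y - y0) < b ->
          Rabs (z - y0) < b -> y <= z -> m * (z - y) <= F x z - F x y).
{ intros x y z Hx Hy Hz Hyz.
  destruct (MVT_gen (fun v => F x v) y z (fun v => Fy x v)) as [w [Hw E]].
  - rewrite Rmin_left, Rmax_right by lra; intros v Hv.
    apply (differentiable_pt_lim_is_derive_2 F x v (Fx x v)), HFb; [exact Hx|].
    apply Rabs_lt_between in Hy; apply Rabs_lt_between in Hz.
    apply Rabs_lt_between; lra.
  - rewrite Rmin_left, Rmax_right by lra; intros v Hv.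
    apply (is_derive_continuity_pt _ v (Fy x v)).
    apply (differentiable_pt_lim_is_derive_2 F x v (Fx x v)), HFb; [exact Hx|].
    apply Rabs_lt_between in Hy; apply Rabs_lt_between in Hz.
    apply Rabs_lt_between; lra.
  - rewrite Rmin_left, Rmax_right in Hw by lra.
    rewrite E; apply Rmult_le_compat_r; [lra|apply Hlow; [exact Hx|]].
    apply Rabs_lt_between in Hy; apply Rabs_lt_between in Hz.
    apply Rabs_lt_between; lra. }
assert (Hlip : forall x y z, Rabs (x - x0) < b -> Rabs (y - y0) < b ->
          Rabs (z - y0) < b -> m * Rabs (z - y) <= Rabs (F x z - F x y)).
{ intros x y z Hx Hy Hz; destruct (Rle_or_lt y z) as [L|L].
  - rewrite (Rabs_pos_eq (z - y)) by lra.
    eapply Rle_trans; [apply (Hinc x); assumption|apply Rle_abs].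
  - rewrite (Rabs_minus_sym z y), (Rabs_minus_sym (F x z)).
    rewrite (Rabs_pos_eq (y - z)) by lra.
    eapply Rle_trans; [apply (Hinc x); try assumption; lra|apply Rle_abs]. }
(* Half of [b] keeps [y0 - c] and [y0 + c] strictly inside the box. There [F x0] is at most
   [- m * c] and at least [m * c], and these signs persist for [x] near [x0]. *)
set (c := b / 2).
assert (Hc1 : Rabs (y0 - c - y0) < b) by (apply Rabs_lt_between; unfold c; lra).
assert (Hc2 : Rabs (y0 + c - y0) < b) by (apply Rabs_lt_between; unfold c; lra).
assert (H00 : Rabs (y0 - y0) < b) by (rewrite Rminus_diag, Rabs_R0; exact Hb).
assert (Hx00 : Rabs (x0 - x0) < b) by (rewrite Rminus_diag, Rabs_R0; exact Hb).
assert (Hcont : forall x y, Rabs (x - x0) < b -> Rabs (y - y0) < b ->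
          continuity_pt (fun u => F u y) x).
{ intros x y Hx Hy; apply (is_derive_continuity_pt _ x (Fx x y)).
  apply (differentiable_pt_lim_is_derive_1 F x y _ (Fy x y)), HFb; assumption. }
assert (Hmc : 0 < m * c) by (apply Rmult_lt_0_compat; unfold c; lra).
destruct (continuity_pt_eps _ x0 (m * c) (Hcont x0 _ Hx00 Hc1) Hmc) as [a1 [Ha1 Hm1]].
destruct (continuity_pt_eps _ x0 (m * c) (Hcont x0 _ Hx00 Hc2) Hmc) as [a2 [Ha2 Hm2]].
set (a := Rmin b (Rmin a1 a2)).
assert (Ha : 0 < a) by (apply Rmin_glb_lt; [|apply Rmin_glb_lt]; assumption).
assert (Hab : a <= b) by apply Rmin_l.
assert (Haa1 : a <= a1) by (eapply Rle_trans; [apply Rmin_r|apply Rmin_l]).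
assert (Haa2 : a <= a2) by (eapply Rle_trans; [apply Rmin_r|apply Rmin_r]).
(* The implication under the existential makes the relation total, with default value 0 away from
   [x0], so that choice yields a function on all of [R]. *)
assert (Hex : forall x, exists y, Rabs (x - x0) < a -> Rabs (y - y0) < b /\ F x y = 0).
{ intro x; destruct (Rlt_dec (Rabs (x - x0)) a) as [Hx|Hx]; [|exists 0; tauto].
  assert (Hxb : Rabs (x - x0) < b) by lra.
  assert (N : F x (y0 - c) < 0).
  { assert (B := Hinc x0 _ _ Hx00 Hc1 H00 ltac:(unfold c; lra)).
    assert (B' := Hm1 x ltac:(lra)); cbv beta in B'.
    apply Rabs_lt_between in B'.
    rewrite H0 in B; replace (y0 - (y0 - c)) with c in B by ring; lra. }
  assert (P : 0 < F x (y0 + c)).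
  { assert (B := Hinc x0 _ _ Hx00 H00 Hc2 ltac:(unfold c; lra)).
    assert (B' := Hm2 x ltac:(lra)); cbv beta in B'.
    apply Rabs_lt_between in B'.
    rewrite H0 in B; replace (y0 + c - y0) with c in B by ring; lra. }
  destruct (Ranalysis5.IVT_interv (fun v => F x v) (y0 - c) (y0 + c)) as [z [Hz E]].
  - intros v Hv; apply (is_derive_continuity_pt _ v (Fy x v)).
    apply (differentiable_pt_lim_is_derive_2 F x v (Fx x v)), HFb; [exact Hxb|].
    apply Rabs_lt_between; unfold c in *; lra.
  - unfold c; lra.
  - exact N.
  - exact P.
  - exists z; intros _; split; [apply Rabs_lt_between; unfold c in *; lra|exact E]. }
destruct (functional_choice _ Hex) as [sigma Hsig].
assert (Huniq : forall x y, Rabs (x - x0) < a -> Rabs (y - y0) < b ->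
          F x y = 0 -> y = sigma x).
{ intros x y Hx Hy E; destruct (Hsig x Hx) as [S1 S2].
  assert (B := Hlip x (sigma x) y ltac:(lra) S1 Hy).
  rewrite E, S2, Rminus_diag, Rabs_R0 in B.
  destruct (Req_dec (y - sigma x) 0) as [D|D]; [lra|].
  apply Rabs_pos_lt in D; nra. }
exists sigma, a, b.
split; [lra|]; split; [lra|]; split.
{ symmetry; apply Huniq; try assumption; rewrite Rminus_diag, Rabs_R0; exact Ha. }
intros x Hx; destruct (Hsig x Hx) as [S1 S2].
assert (Hnear : exists e, 0 < e /\ forall u, Rabs (u - x) < e -> Rabs (u - x0) < a).
{ exists (a - Rabs (x - x0)); split; [lra|intros u Hu].
  replace (u - x0) with ((u - x) + (x - x0)) by ring.
  eapply Rle_lt_trans; [apply Rabs_triang|lra]. }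
destruct Hnear as [e [He Hnear]].
repeat split; try assumption; [|intros; apply Huniq; assumption].
exists (- Fx x (sigma x) / Fy x (sigma x)).
apply (is_derive_implicit F).
- apply HFb; lra.
- assert (B := Hlow x (sigma x) ltac:(lra) S1); lra.
(* Continuity of [sigma]: [m * |sigma u - sigma x|] is at most [|F u (sigma u) - F u (sigma x)|].
   Both [F u (sigma u)] and [F x (sigma x)] vanish, so this is [|F u (sigma x) - F x (sigma x)|],
   which is small. *)
- apply continuity_pt_locally; intro eps.
  assert (Hme : 0 < m * eps) by (apply Rmult_lt_0_compat; [lra|apply cond_pos]).
  destruct (continuity_pt_eps _ x (m * eps) (Hcont x (sigma x) ltac:(lra) S1) Hme)
    as [d2 [Hd2 Hc]].
  assert (Hd : 0 < Rmin e d2) by (apply Rmin_glb_lt; assumption).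
  exists (mkposreal _ Hd); intros u Hu.
  assert (Hu' : Rabs (u - x) < Rmin e d2) by exact Hu.
  assert (Hu1 : Rabs (u - x0) < a)
    by (apply Hnear; eapply Rlt_le_trans; [exact Hu'|apply Rmin_l]).
  assert (Hu2 : Rabs (u - x) < d2) by (eapply Rlt_le_trans; [exact Hu'|apply Rmin_r]).
  destruct (Hsig u Hu1) as [T1 T2].
  assert (B := Hlip u (sigma x) (sigma u) ltac:(lra) S1 T1).
  assert (B' := Hc u Hu2); cbv beta in B'.
  rewrite S2 in B'; rewrite T2 in B.
  rewrite (Rabs_minus_sym 0) in B.
  apply Rmult_lt_reg_l with m; [exact Hm|lra].
- exists e; split; [exact He|intros u Hu; apply Hsig, Hnear, Hu].
Qed.

(** * Calculus of continuously differentiable functions of two variables *)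

(** The partial derivatives stay existential, so the closure lemmas give the regularity of [reduced]
    without any formula for its derivatives. *)
Definition C1_on (U : R -> R -> Prop) (f : R -> R -> R) : Prop :=
  exists fx fy : R -> R -> R, forall x y, U x y ->
    differentiable_pt_lim f x y (fx x y) (fy x y) /\
    continuity_2d_pt fx x y /\ continuity_2d_pt fy x y.

Section C1Calculus.

Variable U : R -> R -> Prop.

Lemma C1_on_fst : C1_on U (fun x _ => x).
Proof.
exists (fun _ _ => 1), (fun _ _ => 0); intros x y _.
split; [|split; apply continuity_2d_pt_const].
apply (differentiable_pt_lim_proj1_0 (fun u => u)), derivable_pt_lim_id.
Qed.

Lemma C1_on_snd : C1_on U (fun _ y => y).
Proof.
exists (fun _ _ => 0), (fun _ _ => 1); intros x y _.
split; [|split; apply continuity_2d_pt_const].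
intro eps; exists (mkposreal 1 Rlt_0_1); intros u v _ _.
replace (v - y - (0 * (u - x) + 1 * (v - y))) with 0 by ring.
rewrite Rabs_R0; apply Rmult_le_pos; [apply Rlt_le, cond_pos|].
eapply Rle_trans; [apply Rabs_pos|apply Rmax_l].
Qed.

Lemma C1_on_const (k : R) : C1_on U (fun _ _ => k).
Proof.
exists (fun _ _ => 0), (fun _ _ => 0); intros x y _.
split; [|split; apply continuity_2d_pt_const].
apply (differentiable_pt_lim_proj1_0 (fun _ => k)), derivable_pt_lim_const.
Qed.

Lemma C1_on_plus (f g : R -> R -> R) :
  C1_on U f -> C1_on U g -> C1_on U (fun x y => f x y + g x y).
Proof.
intros [fx [fy Hf]] [gx [gy Hg]].
exists (fun x y => 1 * fx x y + 1 * gx x y), (fun x y => 1 * fy x y + 1 * gy x y).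
intros x y Hxy; destruct (Hf x y Hxy) as [F1 [F2 F3]], (Hg x y Hxy) as [G1 [G2 G3]].
split; [|split; apply continuity_2d_pt_plus; apply continuity_2d_pt_mult;
         try apply continuity_2d_pt_const; assumption].
apply (differentiable_pt_lim_comp Rplus); try assumption.
intro eps; exists (mkposreal 1 Rlt_0_1); intros u v _ _.
match goal with |- Rabs ?e <= _ => replace e with 0 by ring end.
rewrite Rabs_R0; apply Rmult_le_pos; [apply Rlt_le, cond_pos|].
eapply Rle_trans; [apply Rabs_pos|apply Rmax_l].
Qed.

Lemma C1_on_mult (f g : R -> R -> R) :
  C1_on U f -> C1_on U g -> C1_on U (fun x y => f x y * g x y).
Proof.
intros [fx [fy Hf]] [gx [gy Hg]].
exists (fun x y => g x y * fx x y + f x y * gx x y),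
       (fun x y => g x y * fy x y + f x y * gy x y).
intros x y Hxy; destruct (Hf x y Hxy) as [F1 [F2 F3]], (Hg x y Hxy) as [G1 [G2 G3]].
assert (Cf : continuity_2d_pt f x y)
  by (apply differentiable_continuity_pt; exists (fx x y), (fy x y); exact F1).
assert (Cg : continuity_2d_pt g x y)
  by (apply differentiable_continuity_pt; exists (gx x y), (gy x y); exact G1).
split; [|split; apply continuity_2d_pt_plus; apply continuity_2d_pt_mult; assumption].
apply (differentiable_pt_lim_comp Rmult); try assumption.
intro eps; exists eps; intros u v Hu Hv.
match goal with |- Rabs ?e <= _ =>
  replace e with ((u - f x y) * (v - g x y)) by ring end.
rewrite Rabs_mult; apply Rmult_le_compat; try apply Rabs_pos; [lra|apply Rmax_r].
Qed.

Lemma C1_on_minus (f g : R -> R -> R) :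
  C1_on U f -> C1_on U g -> C1_on U (fun x y => f x y - g x y).
Proof.
intros Hf Hg.
destruct (C1_on_plus _ _ Hf (C1_on_mult _ _ (C1_on_const (- 1)) Hg)) as [hx [hy H]].
exists hx, hy; intros x y Hxy; destruct (H x y Hxy) as [H1 H2]; split; [|exact H2].
revert H1; apply differentiable_pt_lim_ext.
exists (mkposreal 1 Rlt_0_1); intros; ring.
Qed.

Lemma C1_on_pow (f : R -> R -> R) (n : nat) :
  C1_on U f -> C1_on U (fun x y => f x y ^ n).
Proof.
intro Hf; induction n as [|n IH]; simpl; [apply C1_on_const|].
apply C1_on_mult; assumption.
Qed.

Lemma C1_on_comp (g dg : R -> R) (f : R -> R -> R) :
  (forall x y, U x y -> is_derive g (f x y) (dg (f x y)) /\ ex_derive dg (f x y)) ->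
  C1_on U f -> C1_on U (fun x y => g (f x y)).
Proof.
intros Hg [fx [fy Hf]].
(* The two-variable chain rule is applied to [g] seen as a function ignoring its second argument,
   which produces the zero terms. *)
exists (fun x y => dg (f x y) * fx x y + 0 * fx x y),
       (fun x y => dg (f x y) * fy x y + 0 * fy x y).
intros x y Hxy; destruct (Hf x y Hxy) as [F1 [F2 F3]], (Hg x y Hxy) as [G1 [l G2]].
assert (C : continuity_2d_pt (fun u v => dg (f u v)) x y).
{ apply continuity_1d_2d_pt_comp; [exact (is_derive_continuity_pt _ _ _ G2)|].
  apply differentiable_continuity_pt; exists (fx x y), (fy x y); exact F1. }
split; [|split; apply continuity_2d_pt_plus; apply continuity_2d_pt_mult;
         try apply continuity_2d_pt_const; assumption].
apply (differentiable_pt_lim_comp (fun u _ => g u) f f); try assumption.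
apply differentiable_pt_lim_proj1_0, is_derive_Reals, G1.
Qed.

End C1Calculus.

Lemma C1_on_differentiable (U : R -> R -> Prop) (f : R -> R -> R) (x y : R) :
  C1_on U f -> U x y -> differentiable_pt f x y.
Proof.
intros [fx [fy Hf]] Hxy; exists (fx x y), (fy x y); apply Hf, Hxy.
Qed.

(** * Bounds on the logarithm *)

(** The difference of the two sides vanishes at 1 and has the nonnegative derivative
    [(u - 1)^2 / (u * (u + 1)^2)]. At [y = (s + 2) / (s - 2)] the lower bound is [4 / s]. *)
Lemma ln_ge_quot (y : R) : 1 <= y -> 2 * (y - 1) / (y + 1) <= ln y.
Proof.
intro Hy.
destruct (MVT_gen (fun u => ln u - 2 * (u - 1) / (u + 1)) 1 y
            (fun u => (u - 1) ^ 2 / (u * (u + 1) ^ 2))) as [w [Hw E]].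
- rewrite Rmin_left, Rmax_right by lra; intros u Hu.
  auto_derive; [lra|field; lra].
- rewrite Rmin_left, Rmax_right by lra; intros u Hu.
  apply (is_derive_continuity_pt _ _ ((u - 1) ^ 2 / (u * (u + 1) ^ 2))).
  auto_derive; [lra|field; lra].
- rewrite Rmin_left, Rmax_right in Hw by lra.
  rewrite ln_1 in E.
  assert (0 <= (w - 1) ^ 2 / (w * (w + 1) ^ 2)).
  { apply Rdiv_le_0_compat; [apply pow2_ge_0|].
    apply Rmult_lt_0_compat; [lra|apply pow_lt; lra]. }
  assert (0 <= (w - 1) ^ 2 / (w * (w + 1) ^ 2) * (y - 1))
    by (apply Rmult_le_pos; lra).
  replace (0 - 2 * (1 - 1) / (1 + 1)) with 0 in E by field; lra.
Qed.

(** Same argument, with derivative [(u - 1)^2 / (2 * u^2)]. At [y = (s + 2) / (s - 2)] the upper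
    bound is [4 * s / (s^2 - 4)]. *)
Lemma ln_le_half_diff (y : R) : 1 <= y -> ln y <= (y - / y) / 2.
Proof.
intro Hy.
destruct (MVT_gen (fun u => (u - / u) / 2 - ln u) 1 y
            (fun u => (u - 1) ^ 2 / (2 * u ^ 2))) as [w [Hw E]].
- rewrite Rmin_left, Rmax_right by lra; intros u Hu.
  auto_derive; [lra|field; lra].
- rewrite Rmin_left, Rmax_right by lra; intros u Hu.
  apply (is_derive_continuity_pt _ _ ((u - 1) ^ 2 / (2 * u ^ 2))).
  auto_derive; [lra|field; lra].
- rewrite Rmin_left, Rmax_right in Hw by lra.
  rewrite ln_1 in E.
  assert (0 <= (w - 1) ^ 2 / (2 * w ^ 2)).
  { apply Rdiv_le_0_compat; [apply pow2_ge_0|].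
    apply Rmult_lt_0_compat; [lra|apply pow_lt; lra]. }
  assert (0 <= (w - 1) ^ 2 / (2 * w ^ 2) * (y - 1))
    by (apply Rmult_le_pos; lra).
  replace ((1 - / 1) / 2 - 0) with 0 in E by field; lra.
Qed.

(** * The equilibrium equations and the bounded axial root *)

Definition Lambda (s : R) : R := ln ((s + 2) / (s - 2)).
(** Clearing [s^2 - d^2] in the axial force leaves [- 3 * A * Mu s] as the term free of [d]. *)
Definition Mu (s : R) : R := s ^ 2 * Lambda s - 4 * s.

Lemma quot_ge1 (s : R) : 2 < s -> 1 <= (s + 2) / (s - 2).
Proof.
intro Hs; apply Rmult_le_reg_r with (s - 2); [lra|].
unfold Rdiv; rewrite Rmult_assoc, Rinv_l; lra.
Qed.

Lemma Lambda_ge (s : R) : 2 < s -> 4 / s <= Lambda s.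
Proof.
intro Hs; eapply Rle_trans; [|apply ln_ge_quot, quot_ge1, Hs].
right; field; repeat split; lra.
Qed.

Lemma Lambda_le (s : R) : 2 < s -> Lambda s <= 4 * (s / (s ^ 2 - 4)).
Proof.
intro Hs; eapply Rle_trans; [apply ln_le_half_diff, quot_ge1, Hs|].
right; field; repeat split; nra.
Qed.

Lemma Lambda_ge0 (s : R) : 2 < s -> 0 <= Lambda s.
Proof.
intro Hs; eapply Rle_trans; [|apply Lambda_ge, Hs].
apply Rdiv_le_0_compat; lra.
Qed.

Lemma Mu_ge0 (s : R) : 2 < s -> 0 <= Mu s.
Proof.
intro Hs; unfold Mu.
assert (s ^ 2 * (4 / s) <= s ^ 2 * Lambda s)
  by (apply Rmult_le_compat_l; [apply pow2_ge_0|apply Lambda_ge, Hs]).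
replace (s ^ 2 * (4 / s)) with (4 * s) in H by (field; lra); lra.
Qed.

Lemma Mu_le (s : R) : 2 < s -> Mu s <= 16 * (s / (s ^ 2 - 4)).
Proof.
intro Hs; unfold Mu.
assert (s ^ 2 * Lambda s <= s ^ 2 * (4 * (s / (s ^ 2 - 4))))
  by (apply Rmult_le_compat_l; [apply pow2_ge_0|apply Lambda_le, Hs]).
replace (16 * (s / (s ^ 2 - 4))) with (s ^ 2 * (4 * (s / (s ^ 2 - 4))) - 4 * s)
  by (field; nra); lra.
Qed.

(* Vanishing of the forces on [P_r] and [P_x], see [radial_force_eq0] and
   [axial_force_eq0]. *)
Definition radial_eq (c A s d : R) : Prop :=
  16 * c ^ 2 * (s ^ 2 - d ^ 2) = (s ^ 2 - 4) * (4 - d ^ 2) ^ 2 * (3 * A * d + s).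

Definition axial_eq (A s d : R) : Prop :=
  3 * A * Lambda s * d ^ 2 + 4 * d - 3 * A * Mu s = 0.

(* Rationalised form of the root, so that it makes sense at [A = 0]. *)
Definition slope (A s : R) : R :=
  Mu s * (6 / (4 + sqrt (16 + 36 * A ^ 2 * (Lambda s * Mu s)))).

(** Right side minus left side of [radial_eq]; with this sign the derivative in [s] at [A = 0],
    [s = s0] is positive. *)
Definition reduced (c A s : R) : R :=
  (s ^ 2 - 4) * (4 - (A * slope A s) ^ 2) ^ 2 * (3 * A * (A * slope A s) + s)
  - 16 * c ^ 2 * (s ^ 2 - (A * slope A s) ^ 2).

Lemma axial_disc_ge0 (A s : R) : 2 < s -> 0 <= 36 * A ^ 2 * (Lambda s * Mu s).
Proof.
intro Hs; apply Rmult_le_pos.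
- apply Rmult_le_pos; [lra|apply pow2_ge_0].
- apply Rmult_le_pos; [apply Lambda_ge0, Hs|apply Mu_ge0, Hs].
Qed.

Lemma axial_eq_slope (A s : R) : 2 < s -> axial_eq A s (A * slope A s).
Proof.
intro Hs; unfold axial_eq, slope.
pose proof (axial_disc_ge0 A s Hs) as Hw.
set (q := sqrt _).
assert (Hq : 0 <= q) by apply sqrt_pos.
assert (Hq2 : q * q = 16 + 36 * A ^ 2 * (Lambda s * Mu s)) by (apply sqrt_sqrt; lra).
(* Over the denominator [(4 + q)^2] everything is a multiple of the defining relation of the square
   root [q]. *)
replace (3 * A * Lambda s * (A * (Mu s * (6 / (4 + q)))) ^ 2
  + 4 * (A * (Mu s * (6 / (4 + q)))) - 3 * A * Mu s)
  with (3 * A * Mu s * (16 + 36 * A ^ 2 * (Lambda s * Mu s) - q * q) / (4 + q) ^ 2)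
  by (field; lra).
rewrite Hq2; field; lra.
Qed.

(* The other root of the quadratic [axial_eq] escapes to infinity as [A -> 0];
   the sign condition excludes it. *)
Lemma axial_eq_inv (A s d : R) : 2 < s -> axial_eq A s d ->
  0 < 4 + 6 * A * Lambda s * d -> d = A * slope A s.
Proof.
unfold axial_eq; intros Hs E Hp; unfold slope.
assert (E' : 3 * A * Mu s = 3 * A * Lambda s * d ^ 2 + 4 * d) by lra.
replace (16 + 36 * A ^ 2 * (Lambda s * Mu s))
  with (16 + 12 * A * Lambda s * (3 * A * Mu s)) by ring.
rewrite E'.
(* By the equation for [d], the discriminant is a perfect square, and the sign hypothesis selects
   its root [4 + 6 * A * Lambda s * d]. *)
replace (16 + _) with ((4 + 6 * A * Lambda s * d) * (4 + 6 * A * Lambda s * d)) by ring.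
rewrite sqrt_square by lra.
transitivity (2 * (3 * A * Mu s) / (4 + (4 + 6 * A * Lambda s * d)));
  [rewrite E'|]; field; lra.
Qed.

(** * Regularity of the reduced equation *)

Lemma C1_on_of_snd (U : R -> R -> Prop) (g dg : R -> R) :
  (forall x y, U x y -> is_derive g y (dg y) /\ ex_derive dg y) ->
  C1_on U (fun _ y => g y).
Proof.
intro Hg; apply (C1_on_comp U g dg (fun _ y => y)); [exact Hg|apply C1_on_snd].
Qed.

Lemma C1_on_Lambda : C1_on (fun _ s => 2 < s) (fun _ s => Lambda s).
Proof.
apply (C1_on_of_snd _ Lambda (fun s => - 4 / (s ^ 2 - 4))); intros _ s Hs; split.
- pose proof (quot_ge1 s Hs).
  unfold Lambda; auto_derive; [repeat split; try lra; unfold Rminus, Rdiv in *; lra|].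
  field; repeat split; nra.
- auto_derive; nra.
Qed.

Lemma C1_on_Mu : C1_on (fun _ s => 2 < s) (fun _ s => Mu s).
Proof.
unfold Mu.
apply C1_on_minus; apply C1_on_mult;
  auto using C1_on_const, C1_on_snd, C1_on_pow, C1_on_Lambda.
Qed.

Lemma C1_on_slope : C1_on (fun _ s => 2 < s) slope.
Proof.
unfold slope; apply C1_on_mult; [apply C1_on_Mu|].
(* Since [Lambda] and [Mu] are nonnegative for [s > 2], the inner function is nonnegative and the
   square root is only taken at arguments at least 16. *)
apply (C1_on_comp _ (fun w => 6 / (4 + sqrt (16 + w)))
  (fun w => - 3 / (sqrt (16 + w) * (4 + sqrt (16 + w)) ^ 2))
  (fun A s => 36 * A ^ 2 * (Lambda s * Mu s))).
- intros A s Hs; pose proof (axial_disc_ge0 A s Hs) as Hw.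
  set (w := 36 * _ * _) in *; clearbody w.
  assert (Hq : 0 < sqrt (16 + w)) by (apply sqrt_lt_R0; lra).
  split; auto_derive.
  + split; lra.
  + field; lra.
  + repeat split; try lra.
    apply Rmult_integral_contrapositive; split; [lra|nra].
- apply C1_on_mult; apply C1_on_mult;
  auto using C1_on_const, C1_on_fst, C1_on_pow, C1_on_Lambda, C1_on_Mu.
Qed.

Lemma C1_on_reduced (c : R) : C1_on (fun _ s => 2 < s) (reduced c).
Proof.
assert (D : C1_on (fun _ s => 2 < s) (fun A s => A * slope A s))
  by (apply C1_on_mult; [apply C1_on_fst|apply C1_on_slope]).
unfold reduced.
repeat first [apply D | apply C1_on_minus | apply C1_on_mult | apply C1_on_pow
  | apply C1_on_plus | apply C1_on_const | apply C1_on_fst | apply C1_on_snd].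
Qed.

(** * A priori bounds on equilibria *)

(** Since [s^2 - d^2 >= 4 - d^2], one factor [4 - d^2] cancels from [radial_eq]; the remaining one
    is at most 4, and [|3 * A * d| < 2]. For [c <> 0] this keeps [s] away from 2. *)
Lemma radial_eq_lower (c A s d : R) : Rabs A <= 1 / 3 -> 2 < s -> d ^ 2 < 4 ->
  radial_eq c A s d -> 4 * c ^ 2 <= (s ^ 2 - 4) * (s + 2).
Proof.
unfold radial_eq; intros HA Hs Hd E.
apply Rabs_le_between in HA.
assert (Hd2 : -2 < d < 2) by (split; nra).
assert (HX : 3 * A * d + s <= s + 2) by nra.
assert (HX0 : 0 < 3 * A * d + s) by nra.
set (X := 3 * A * d + s) in *; clearbody X.
assert (Hu : 0 < 4 - d ^ 2) by lra.
assert (Hu4 : 4 - d ^ 2 <= 4) by nra.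
set (u := 4 - d ^ 2) in *.
assert (Hv : 0 < s ^ 2 - 4) by nra.
assert (Hc : 0 <= c ^ 2) by apply pow2_ge_0.
assert (B : 16 * c ^ 2 <= (s ^ 2 - 4) * u * X).
{ apply Rmult_le_reg_r with u; [exact Hu|].
  replace ((s ^ 2 - 4) * u * X * u) with ((s ^ 2 - 4) * u ^ 2 * X) by ring.
  rewrite <- E; apply Rmult_le_compat_l; [lra|unfold u; lra]. }
assert (B' : (s ^ 2 - 4) * u * X <= (s ^ 2 - 4) * 4 * (s + 2)).
{ apply Rmult_le_compat; try lra.
  - apply Rmult_le_pos; lra.
  - apply Rmult_le_compat_l; lra. }
lra.
Qed.

(** The quotient [s / (s^2 - 4)] is the one occurring in [Lambda_le] and [Mu_le], so this bounds
    [Lambda] and [Mu] uniformly over all equilibria. *)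
Lemma radial_eq_quot_bound (c : R) : c <> 0 ->
  exists kappa, 0 < kappa /\ forall A s d, Rabs A <= 1 / 3 -> 2 < s -> d ^ 2 < 4 ->
    radial_eq c A s d -> s / (s ^ 2 - 4) <= kappa.
Proof.
(* Lower bound for [s^2 - 4]: either [s > 3], or [s + 2 <= 5] in [radial_eq_lower]. *)
intro Hc; set (v := Rmin 5 (4 * c ^ 2 / 5)).
assert (Hc2 : 0 < c ^ 2) by (rewrite <- Rsqr_pow2; apply Rsqr_pos_lt, Hc).
assert (Hv : 0 < v) by (apply Rmin_glb_lt; lra).
assert (Hiv : 0 < / v) by (apply Rinv_0_lt_compat, Hv).
(* From [(s - 2)^2 >= 0] one has [s <= (s^2 - 4) / 4 + 2], and [2 <= (2 / v) * (s^2 - 4)]. *)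
exists (1 / 4 + 2 * / v); split; [lra|].
intros A s d HA Hs Hd E; pose proof (radial_eq_lower c A s d HA Hs Hd E) as L.
assert (Hvs : v <= s ^ 2 - 4).
{ destruct (Rle_or_lt s 3).
  - apply Rle_trans with (4 * c ^ 2 / 5); [apply Rmin_r|nra].
  - apply Rle_trans with 5; [apply Rmin_l|nra]. }
apply Rmult_le_reg_r with (s ^ 2 - 4); [lra|].
unfold Rdiv at 1; rewrite Rmult_assoc, Rinv_l, Rmult_1_r by lra.
assert (/ v * v <= / v * (s ^ 2 - 4)) by (apply Rmult_le_compat_l; lra).
rewrite Rinv_l in H by lra; nra.
Qed.

(** The roots of [s^2 - c^2 * s - 4] have product [-4], so the second one is [- 4 / s0]. *)
Lemma root_factor (c s0 s : R) : 0 < s0 -> s0 ^ 2 - 4 = c ^ 2 * s0 ->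
  s ^ 2 - 4 - c ^ 2 * s = (s - s0) * (s + 4 / s0).
Proof.
intros H0 E; replace (c ^ 2) with ((s0 ^ 2 - 4) / s0); [field; lra|].
rewrite E; field; lra.
Qed.

(** Relative to the case [A = d = 0], solved by [s0], the radial equation is perturbed only through
    [d^2] and [A * d], both [O(A^2)] when [d = O(A)]. The factor [s + 4 / s0 >= s] allows division
    by [16 * s^2]. *)
Lemma radial_eq_close (c s0 A s d b : R) :
  0 < s0 -> s0 ^ 2 - 4 = c ^ 2 * s0 ->
  Rabs A <= 1 / 3 -> 0 <= b -> b * Rabs A <= 1 -> 2 < s -> d ^ 2 < 4 ->
  Rabs d <= b * Rabs A -> radial_eq c A s d ->
  Rabs (s - s0) <=
    (c ^ 2 * b ^ 2 / 4 + (s0 + c ^ 2 / 4 + 3) * b ^ 2 + 3 * b) * A ^ 2.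
Proof.
unfold radial_eq; intros H0 E0 HA Hb HbA Hs Hd2 Hd E.
pose proof (Rabs_pos A) as HA0; pose proof (Rabs_pos d) as Hd0.
rewrite <- (pow2_abs A).
set (a := Rabs A) in *.
assert (Hc : 0 <= c ^ 2) by apply pow2_ge_0.
assert (Hdd : d ^ 2 <= b ^ 2 * a ^ 2) by (rewrite <- (pow2_abs d); nra).
assert (HAd : Rabs (3 * A * d * (4 - d ^ 2) ^ 2) <= 48 * b * a ^ 2).
{ rewrite !Rabs_mult, (Rabs_pos_eq 3), (Rabs_pos_eq ((4 - d ^ 2) ^ 2))
    by (try apply pow2_ge_0; lra).
  fold a.
  assert (Hu : (4 - d ^ 2) ^ 2 <= 16) by (pose proof (pow2_ge_0 d); nra).
  apply Rle_trans with (3 * a * (b * a) * 16); [|right; ring].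
  apply Rmult_le_compat; try apply pow2_ge_0; try lra.
  - apply Rmult_le_pos; lra.
  - apply Rmult_le_compat_l; lra. }
assert (Hq : 0 <= s * (8 * d ^ 2 - d ^ 4) <= 8 * s * (b ^ 2 * a ^ 2)).
{ replace (d ^ 4) with (d ^ 2 * d ^ 2) by ring.
  pose proof (pow2_ge_0 d).
  assert (0 <= 8 * d ^ 2 - d ^ 2 * d ^ 2 <= 8 * d ^ 2) by nra.
  split; [apply Rmult_le_pos; lra|].
  apply Rle_trans with (s * (8 * (b ^ 2 * a ^ 2))); [|right; ring].
  apply Rmult_le_compat_l; lra. }
assert (Key : 16 * s * ((s - s0) * (s + 4 / s0)) =
  - (16 * c ^ 2 * d ^ 2)
  + (s ^ 2 - 4) * (s * (8 * d ^ 2 - d ^ 4) - 3 * A * d * (4 - d ^ 2) ^ 2)).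
{ rewrite <- (root_factor c s0 s H0 E0).
  replace (16 * s * (s ^ 2 - 4 - c ^ 2 * s))
    with (16 * s * (s ^ 2 - 4) - 16 * c ^ 2 * (s ^ 2 - d ^ 2) - 16 * c ^ 2 * d ^ 2) by ring.
  rewrite E; ring. }
set (p := 3 * A * d * (4 - d ^ 2) ^ 2) in *.
set (q := s * (8 * d ^ 2 - d ^ 4)) in *.
assert (B1 : Rabs (- (16 * c ^ 2 * d ^ 2) + (s ^ 2 - 4) * (q - p))
  <= 16 * c ^ 2 * (b ^ 2 * a ^ 2) + s ^ 2 * (8 * s * (b ^ 2 * a ^ 2) + 48 * b * a ^ 2)).
{ eapply Rle_trans; [apply Rabs_triang|apply Rplus_le_compat].
  - rewrite Rabs_Ropp, Rabs_pos_eq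
      by (apply Rmult_le_pos; [lra|apply pow2_ge_0]).
    apply Rmult_le_compat_l; lra.
  - rewrite Rabs_mult; apply Rmult_le_compat; try apply Rabs_pos.
    + rewrite Rabs_pos_eq; nra.
    + unfold Rminus; eapply Rle_trans; [apply Rabs_triang|].
      rewrite Rabs_Ropp, (Rabs_pos_eq q) by lra; lra. }
rewrite <- Key in B1.
assert (H4 : 0 < 4 / s0) by (apply Rdiv_lt_0_compat; lra).
assert (B2 : 16 * s ^ 2 * Rabs (s - s0) <= Rabs (16 * s * ((s - s0) * (s + 4 / s0)))).
{ rewrite !Rabs_mult, (Rabs_pos_eq 16), (Rabs_pos_eq s), (Rabs_pos_eq (s + 4 / s0)) by lra.
  pose proof (Rabs_pos (s - s0)).
  replace (16 * s ^ 2 * Rabs (s - s0)) with (16 * s * (Rabs (s - s0) * s)) by ring.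
  repeat apply Rmult_le_compat_l; lra. }
assert (B3 : Rabs (s - s0) <= c ^ 2 / 4 * (b ^ 2 * a ^ 2) + s / 2 * (b ^ 2 * a ^ 2)
               + 3 * (b * a ^ 2)).
{ apply Rmult_le_reg_l with (16 * s ^ 2); [nra|].
  eapply Rle_trans; [eapply Rle_trans; [exact B2|exact B1]|].
  assert (0 <= c ^ 2 * (b ^ 2 * a ^ 2) * (s ^ 2 - 4))
    by (apply Rmult_le_pos; [apply Rmult_le_pos; [|apply Rmult_le_pos]; apply pow2_ge_0|nra]).
  lra. }
assert (HB1 : b ^ 2 * a ^ 2 <= 1) by (assert (0 <= b * a) by (apply Rmult_le_pos; lra); nra).
assert (HB0 : 0 <= b ^ 2 * a ^ 2) by (apply Rmult_le_pos; apply pow2_ge_0).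
assert (HB2 : b * a ^ 2 <= 1) by (assert (0 <= b * a) by (apply Rmult_le_pos; lra); nra).
(* The bound [B3] still contains [s]. Used first with [b^2 * a^2 <= 1], it bounds [s] itself;
   reinserting that bound gives a constant independent of [s]. *)
assert (HS : s <= 2 * (s0 + c ^ 2 / 4 + 3)).
{ apply Rabs_le_between in B3.
  assert (c ^ 2 / 4 * (b ^ 2 * a ^ 2) <= c ^ 2 / 4 * 1) by (apply Rmult_le_compat_l; lra).
  assert (s / 2 * (b ^ 2 * a ^ 2) <= s / 2 * 1) by (apply Rmult_le_compat_l; lra).
  lra. }
assert (s / 2 * (b ^ 2 * a ^ 2) <= (s0 + c ^ 2 / 4 + 3) * (b ^ 2 * a ^ 2))
  by (apply Rmult_le_compat_r; lra).
lra.
Qed.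

Lemma circular_apriori (c s0 : R) : c <> 0 -> 0 < s0 -> s0 ^ 2 - 4 = c ^ 2 * s0 ->
  exists K a, 0 <= K /\ 0 < a <= 1 / 3 /\
    forall A s d, Rabs A < a -> 2 < s -> d ^ 2 < 4 ->
      radial_eq c A s d -> axial_eq A s d ->
      Rabs (s - s0) <= K * A ^ 2 /\ 0 < 4 + 6 * A * Lambda s * d.
Proof.
intros Hc H0 E0; destruct (radial_eq_quot_bound c Hc) as [k [Hk Hquot]].
(* The axial equation reads [d = 3/4 * A * (Mu s - Lambda s * d^2)], and both terms in the bracket
   lie between 0 and [16 * k]; hence [|d| <= 12 * k * |A|]. *)
set (b := 12 * k).
exists (c ^ 2 * b ^ 2 / 4 + (s0 + c ^ 2 / 4 + 3) * b ^ 2 + 3 * b),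
  (* This radius gives [b * |A| <= 1] and, through [Lambda s <= 4 * k] and [|d| < 2],
     [|6 * A * Lambda s * d| < 4]. *)
  (Rmin (1 / 3) (/ (24 * k))).
assert (Hc2 : 0 <= c ^ 2) by apply pow2_ge_0.
assert (Hi : 0 < / (24 * k)) by (apply Rinv_0_lt_compat; lra).
split.
{ assert (0 <= b ^ 2) by apply pow2_ge_0.
  assert (0 <= c ^ 2 * b ^ 2) by (apply Rmult_le_pos; lra).
  assert (0 <= (s0 + c ^ 2 / 4 + 3) * b ^ 2) by (apply Rmult_le_pos; lra).
  unfold b in *; lra. }
split; [split; [apply Rmin_glb_lt; lra|apply Rmin_l]|].
intros A s d HA Hs Hd R1 R2.
assert (HA1 : Rabs A < 1 / 3) by (eapply Rlt_le_trans; [exact HA|apply Rmin_l]).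
assert (HA2 : 24 * k * Rabs A < 1).
{ replace 1 with (24 * k * / (24 * k)) by (field; lra).
  apply Rmult_lt_compat_l; [lra|].
  eapply Rlt_le_trans; [exact HA|apply Rmin_r]. }
pose proof (Hquot A s d (Rlt_le _ _ HA1) Hs Hd R1) as Q.
pose proof (Lambda_ge0 s Hs) as L0; pose proof (Lambda_le s Hs) as L1.
pose proof (Mu_ge0 s Hs) as M0; pose proof (Mu_le s Hs) as M1.
pose proof (Rabs_pos A) as PA.
pose proof (pow2_ge_0 d) as Hd0.
assert (Bd : Rabs d <= b * Rabs A).
{ unfold axial_eq in R2.
  replace d with (3 / 4 * A * (Mu s - Lambda s * d ^ 2)) by lra.
  rewrite !Rabs_mult, (Rabs_pos_eq (3 / 4)) by lra.
  assert (Rabs (Mu s - Lambda s * d ^ 2) <= 16 * k)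
    by (apply Rabs_le_between; nra).
  unfold b; nra. }
split.
- apply radial_eq_close with (d := d); try assumption; unfold b; try lra.
- assert (HH : Rabs (6 * A * Lambda s * d) < 4).
  { rewrite !Rabs_mult, (Rabs_pos_eq 6), (Rabs_pos_eq (Lambda s)) by lra.
    assert (Rabs d < 2)
      by (rewrite <- (Rabs_pos_eq 2) by lra; apply Rsqr_lt_abs_0; rewrite !Rsqr_pow2; lra).
    pose proof (Rabs_pos d).
    assert (Rabs A * Lambda s <= Rabs A * (4 * k)) by (apply Rmult_le_compat_l; lra).
    assert (0 <= Rabs A * Lambda s) by (apply Rmult_le_pos; lra).
    nra. }
  apply Rabs_lt_between in HH; lra.
Qed.

(** * Prolate spheroidal coordinates and the forces *)

(** The foci lie on the axis at [1 - A] and [- 1 - A]. The product [d * s] is the difference of the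
    squared focal distances, [- 4 * (A + x)], which gives [x]; then [rho1 = (s + d) / 2] gives
    [r]. *)
Lemma coords_of_position (A r x : R) : 0 < r ->
  let s := s_coord A r x in let d := d_coord A r x in
  16 * r ^ 2 = (s ^ 2 - 4) * (4 - d ^ 2) /\ d ^ 2 < 4 /\ x = - A - d * s / 4.
Proof.
intros Hr s d.
assert (Hs : 2 < s) by apply s_coord_gt2, Hr.
pose proof (rho1_sq A r x Hr) as H1; pose proof (rho2_sq A r x Hr) as H2.
assert (Hx : x = - A - d * s / 4) by (unfold d, s, d_coord, s_coord; nra).
assert (H3 : 16 * r ^ 2 = (s ^ 2 - 4) * (4 - d ^ 2)).
{ assert (E : rho1 A r x = (s + d) / 2) by (unfold s, d, s_coord, d_coord; field).
  rewrite E in H1.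
  replace (A + x - 1) with (- d * s / 4 - 1) in H1 by (rewrite Hx; field).
  lra. }
repeat split; try assumption.
assert (0 < r ^ 2) by (apply pow_lt; exact Hr).
assert (0 < s ^ 2 - 4) by nra; nra.
Qed.

Lemma position_of_coords (A s d : R) : 2 < s -> d ^ 2 < 4 ->
  let r := sqrt ((s ^ 2 - 4) * (4 - d ^ 2)) / 4 in let x := - A - d * s / 4 in
  0 < r /\ s_coord A r x = s /\ d_coord A r x = d.
Proof.
intros Hs Hd r x.
assert (Hv : 0 < (s ^ 2 - 4) * (4 - d ^ 2)) by (apply Rmult_lt_0_compat; nra).
assert (Hr : 0 < r) by (apply Rdiv_lt_0_compat; [apply sqrt_lt_R0, Hv|lra]).
assert (Hr2 : r ^ 2 = (s ^ 2 - 4) * (4 - d ^ 2) / 16).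
{ unfold r; rewrite <- (pow2_sqrt _ (Rlt_le _ _ Hv)) at 2; field. }
assert (Hd2 : -2 < d < 2) by (split; nra).
assert (E1 : rho1 A r x = (s + d) / 2).
{ unfold rho1; rewrite Hr2, <- (sqrt_square ((s + d) / 2)) by lra.
  f_equal; unfold x; field. }
assert (E2 : rho2 A r x = (s - d) / 2).
{ unfold rho2; rewrite Hr2, <- (sqrt_square ((s - d) / 2)) by lra.
  f_equal; unfold x; field. }
unfold s_coord, d_coord; rewrite E1, E2; repeat split; [exact Hr|field|field].
Qed.

Lemma radial_force_eq0 (c A r s d : R) : 0 < r -> 2 < s -> d ^ 2 < 4 ->
  16 * r ^ 2 = (s ^ 2 - 4) * (4 - d ^ 2) ->
  c ^ 2 / r ^ 3 - 16 * r * (3 * A * d + s) / ((s ^ 2 - d ^ 2) * (s ^ 2 - 4)) = 0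
  <-> radial_eq c A s d.
Proof.
intros Hr Hs Hd E; unfold radial_eq.
assert (Hv : 0 < s ^ 2 - 4) by nra.
assert (Hy : 0 < s ^ 2 - d ^ 2) by nra.
assert (F : c ^ 2 / r ^ 3 - 16 * r * (3 * A * d + s) / ((s ^ 2 - d ^ 2) * (s ^ 2 - 4))
  = (16 * c ^ 2 * (s ^ 2 - d ^ 2) - (s ^ 2 - 4) * (4 - d ^ 2) ^ 2 * (3 * A * d + s))
    / (16 * r ^ 3 * (s ^ 2 - d ^ 2))).
(* Over a common denominator the numerator depends on [r] only through [r^4]; expressing it by [s]
   and [d] frees a factor [s^2 - 4] that cancels. *)
{ transitivity ((c ^ 2 * (s ^ 2 - d ^ 2) * (s ^ 2 - 4)
     - (16 * r ^ 2) ^ 2 / 16 * (3 * A * d + s)) / (r ^ 3 * (s ^ 2 - d ^ 2) * (s ^ 2 - 4))).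
  - field; lra.
  - rewrite E; field; lra. }
rewrite F; split; intro H.
- apply Rmult_integral in H; destruct H as [H|H]; [lra|].
  exfalso; revert H; apply Rinv_neq_0_compat.
  assert (0 < r ^ 3) by (apply pow_lt; exact Hr); nra.
- rewrite H; unfold Rdiv; ring.
Qed.

Lemma axial_force_eq0 (A s d : R) : 2 < s -> d ^ 2 < 4 ->
  (4 * d + 12 * A * s) / (s ^ 2 - d ^ 2) - 3 * A * ln ((s + 2) / (s - 2)) = 0
  <-> axial_eq A s d.
Proof.
intros Hs Hd; unfold axial_eq, Mu; fold (Lambda s).
assert (Hy : 0 < s ^ 2 - d ^ 2) by nra.
replace ((4 * d + 12 * A * s) / (s ^ 2 - d ^ 2) - 3 * A * Lambda s)
  with ((3 * A * Lambda s * d ^ 2 + 4 * d - 3 * A * (s ^ 2 * Lambda s - 4 * s))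
        / (s ^ 2 - d ^ 2)) by (field; lra).
split; intro H.
- apply Rmult_integral in H; destruct H as [H|H]; [exact H|].
  exfalso; revert H; apply Rinv_neq_0_compat; lra.
- rewrite H; unfold Rdiv; ring.
Qed.

(** * Circular solutions and equilibria *)

Lemma is_derive_constant (f : R -> R) (t l : R) :
  (forall u v, f u = f v) -> is_derive f t l -> l = 0.
Proof.
intros Hf Hd.
rewrite <- (is_derive_unique f t l Hd), (Derive_ext f (fun _ => f 0)).
- apply Derive_const.
- intro u; apply Hf.
Qed.

Lemma is_derive_const_affine (f : R -> R) (w : R) :
  (forall t, is_derive f t w) -> forall t, f t = f 0 + w * t.
Proof.
intros Hf t; destruct (MVT_gen f 0 t (fun _ => w)) as [z [_ E]].
- intros u _; apply Hf.
- intros u _; exact (is_derive_continuity_pt _ _ _ (Hf u)).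
- lra.
Qed.

(** Constant [r] and [x] force zero momenta [p_r] and [p_x]; these being constant in turn, both
    forces vanish. The angle then has the constant speed [c / r^2]. *)
Lemma circular_solution_equations (A c : R) (h : R -> phase) :
  is_solution A h -> is_circular h -> (forall t, p_theta (h t) = c) ->
  let r := q_r (h 0) in let x := q_x (h 0) in
  let s := s_coord A r x in let d := d_coord A r x in
  0 < r /\ radial_eq c A s d /\ axial_eq A s d /\
  forall t, q_r (h t) = r /\ q_theta (h t) = q_theta (h 0) + c / r ^ 2 * t /\
    q_x (h t) = x /\ p_r (h t) = 0 /\ p_x (h t) = 0.
Proof.
intros Hsol Hcirc Hc r x s d.
assert (Hr : 0 < r) by apply Hsol.
assert (Hs : 2 < s) by apply s_coord_gt2, Hr.
destruct (coords_of_position A r x Hr) as [E1 [E2 _]]; fold s d in E1, E2.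
assert (Pr : forall t, p_r (h t) = 0).
{ intro t; rewrite <- (dH_dprE A (h t)).
  apply (is_derive_constant (fun u => q_r (h u)) t); [|apply Hsol].
  intros u v; apply Hcirc. }
assert (Px : forall t, p_x (h t) = 0).
{ intro t; rewrite <- (dH_dpxE A (h t)).
  apply (is_derive_constant (fun u => q_x (h u)) t); [|apply Hsol].
  intros u v; apply Hcirc. }
split; [exact Hr|]; split; [|split].
- apply (radial_force_eq0 c A r s d Hr Hs E2 E1).
  rewrite <- (Hc 0).
  transitivity (- dH_dr A (h 0)); [symmetry; exact (dH_drE A (h 0) Hr)|].
  apply (is_derive_constant (fun u => p_r (h u)) 0); [|apply Hsol].
  intros u v; rewrite !Pr; reflexivity.
- apply (axial_force_eq0 A s d Hs E2).
  transitivity (- dH_dx A (h 0)); [symmetry; exact (dH_dxE A (h 0) Hr)|].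
  apply (is_derive_constant (fun u => p_x (h u)) 0); [|apply Hsol].
  intros u v; rewrite !Px; reflexivity.
- intro t; split; [apply Hcirc|]; split; [|split; [apply Hcirc|auto]].
  apply (is_derive_const_affine (fun u => q_theta (h u))); intro u.
  destruct (Hsol u) as [Hu [_ [Hth _]]].
  rewrite (dH_dpthetaE A (h u) Hu), Hc in Hth.
  rewrite (proj1 (Hcirc u 0)) in Hth; exact Hth.
Qed.

(** Representative with initial angle 0 of its class under [same_orbit]. *)
Definition circular_orbit (c r x t : R) : phase := Phase r (c / r ^ 2 * t) x 0 c 0.

Lemma circular_orbit_periodic (c r x : R) : c <> 0 -> 0 < r ->
  is_periodic (circular_orbit c r x).
Proof.
intros Hc Hr.
assert (Hr2 : 0 < r ^ 2) by (apply pow_lt; exact Hr).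
pose proof PI_RGT_0.
(* The period must be positive, so the sign of [c] decides whether the angle gains or loses one
   turn. *)
destruct (Rdichotomy c 0 Hc) as [L|L].
- exists (2 * PI * r ^ 2 / - c); split; [apply Rdiv_lt_0_compat; nra|].
  intro t; simpl; repeat split; exists (- 1)%Z.
  replace (IZR (- 1)) with (- 1) by reflexivity; field; split; lra.
- exists (2 * PI * r ^ 2 / c); split; [apply Rdiv_lt_0_compat; nra|].
  intro t; simpl; repeat split; exists 1%Z; field; split; lra.
Qed.

Lemma circular_orbit_solution (A c r x : R) : 0 < r ->
  let s := s_coord A r x in let d := d_coord A r x in
  radial_eq c A s d -> axial_eq A s d -> is_solution A (circular_orbit c r x).
Proof.
intros Hr s d R1 R2 t.
assert (Hs : 2 < s) by apply s_coord_gt2, Hr.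
destruct (coords_of_position A r x Hr) as [E1 [E2 _]]; fold s d in E1, E2.
rewrite dH_dprE, dH_dpxE, dH_dthetaE, Ropp_0.
rewrite (dH_dpthetaE A (circular_orbit c r x t) Hr).
rewrite (dH_drE A (circular_orbit c r x t) Hr), (dH_dxE A (circular_orbit c r x t) Hr).
simpl q_r; simpl q_x; simpl q_theta; simpl p_r; simpl p_x; simpl p_theta; fold s d.
rewrite (proj2 (radial_force_eq0 c A r s d Hr Hs E2 E1) R1).
rewrite (proj2 (axial_force_eq0 A s d Hs E2) R2).
split; [exact Hr|].
split; [apply (@is_derive_const R_AbsRing R_NormedModule)|].
split; [change (is_derive (fun u => c / r ^ 2 * u) t (c / r ^ 2));
        auto_derive; [exact I|field; lra]|].
split; [|split; [|split]]; apply (@is_derive_const R_AbsRing R_NormedModule).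
Qed.

(** * Continuation in [A] and assembly of the theorem *)

(** With the factor [A] explicit, the remainder is [A * (g A - g 0)], so a single derivative of [g]
    at 0 suffices. It is used for [d], with [g] the slope along the branch. *)
Lemma is_O_sq_mul_id (g : R -> R) : ex_derive g 0 ->
  is_O_sq (fun A => A * g A - Derive (fun B => B * g B) 0 * A).
Proof.
intros [l Hl].
assert (E : Derive (fun B => B * g B) 0 = g 0).
{ apply is_derive_unique; auto_derive; [exists l; exact Hl|ring]. }
rewrite E; clear E.
apply is_derive_Reals in Hl; destruct (Hl 1 Rlt_0_1) as [delta Hd].
exists (Rabs l + 1), delta; split; [apply cond_pos|intros A HA].
replace (A * g A - g 0 * A) with (A * (g A - g 0)) by ring.
destruct (Req_dec A 0) as [Z|Z].
{ rewrite Z, Rmult_0_l, Rabs_R0; right; ring. }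
specialize (Hd A Z HA); rewrite Rplus_0_l in Hd.
replace (A * (g A - g 0)) with (A * A * (((g A - g 0) / A - l) + l)) by (field; exact Z).
rewrite Rabs_mult, (Rabs_pos_eq (A * A)) by nra.
pose proof (Rabs_triang ((g A - g 0) / A - l) l).
assert (0 <= A ^ 2) by apply pow2_ge_0; nra.
Qed.

Lemma s0_root (c : R) :
  let s0 := 1 / 2 * (c ^ 2 + sqrt (c ^ 4 + 16)) in
  0 < s0 /\ s0 ^ 2 - 4 = c ^ 2 * s0.
Proof.
intro s0.
assert (H4 : 0 <= c ^ 4) by (replace (c ^ 4) with ((c ^ 2) ^ 2) by ring; apply pow2_ge_0).
assert (Hq : 0 < sqrt (c ^ 4 + 16)) by (apply sqrt_lt_R0; lra).
pose proof (pow2_sqrt (c ^ 4 + 16) ltac:(lra)) as Hq2.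
pose proof (pow2_ge_0 c); unfold s0; split; [lra|].
set (q := sqrt (c ^ 4 + 16)) in *.
replace ((1 / 2 * (c ^ 2 + q)) ^ 2) with ((c ^ 4 + 2 * c ^ 2 * q + q ^ 2) / 4) by field.
rewrite Hq2; field.
Qed.

Lemma reduced_implicit_function (c s0 : R) :
  c <> 0 -> 0 < s0 -> s0 ^ 2 - 4 = c ^ 2 * s0 ->
  exists (sigma : R -> R) (a b : R), 0 < a /\ 0 < b /\ sigma 0 = s0 /\
    (forall s, Rabs (s - s0) < b -> 2 < s) /\
    forall A, Rabs A < a ->
      Rabs (sigma A - s0) < b /\ reduced c A (sigma A) = 0 /\ ex_derive sigma A /\
      (forall s, Rabs (s - s0) < b -> reduced c A s = 0 -> s = sigma A).
Proof.
intros Hc H0 E0.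
assert (Hc2 : 0 < c ^ 2) by (rewrite <- Rsqr_pow2; apply Rsqr_pos_lt, Hc).
assert (Hs0 : 2 < s0) by nra.
destruct (C1_on_reduced c) as [Fx [Fy HF]].
assert (Hbox : forall s, Rabs (s - s0) < s0 - 2 -> 2 < s)
  by (intros s Hs; apply Rabs_lt_between in Hs; lra).
(* [Fy] is known only to exist; its value at the base point is read off the slice [A = 0], where
   [reduced] is a polynomial. *)
assert (Eq0 : forall s, reduced c 0 s = 16 * s * (s ^ 2 - 4) - 16 * c ^ 2 * s ^ 2)
  by (intro s; unfold reduced; ring).
assert (Hder : Fy 0 s0 = 16 * s0 ^ 2 + 64).
{ rewrite <- (is_derive_unique _ _ _
    (differentiable_pt_lim_is_derive_2 _ _ _ _ _ (proj1 (HF 0 s0 Hs0)))).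
  etransitivity; [exact (Derive_ext _ _ s0 Eq0)|]; apply is_derive_unique; auto_derive; [exact I|].
  transitivity (48 * s0 ^ 2 - 64 - 32 * (c ^ 2 * s0)); [ring|].
  rewrite <- E0; ring. }
destruct (implicit_function (reduced c) Fx Fy 0 s0 (s0 - 2)) as
  [sigma [a [b [[Ha _] [[Hb Hbs] [Hs Hsig]]]]]].
- lra.
- intros A s _ Hs; apply HF, Hbox, Hs.
- apply HF, Hs0.
- rewrite Eq0, E0; ring.
- rewrite Hder; nra.
- exists sigma, a, b; repeat split; try assumption.
  + intros s Hss; apply Hbox; lra.
  + apply Hsig; rewrite Rminus_0_r; assumption.
  + apply Hsig; rewrite Rminus_0_r; assumption.
  + apply Hsig; rewrite Rminus_0_r; assumption.
  + apply Hsig; rewrite Rminus_0_r; assumption.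
Qed.

Lemma reduced_radial_eq (c A s : R) :
  reduced c A s = 0 <-> radial_eq c A s (A * slope A s).
Proof. unfold reduced, radial_eq; split; intro H; lra. Qed.

Lemma ex_derive_comp_C1 (U : R -> R -> Prop) (f : R -> R -> R) (sigma : R -> R) (x : R) :
  C1_on U f -> U x (sigma x) -> ex_derive sigma x -> ex_derive (fun u => f u (sigma u)) x.
Proof.
intros Hf Hx [l Hl].
destruct (C1_on_differentiable U f x (sigma x) Hf Hx) as [lx [ly HF]].
exists (lx * 1 + ly * l); apply is_derive_Reals.
apply (derivable_pt_lim_comp_2d f (fun u => u) sigma); [exact HF| |].
- apply derivable_pt_lim_id.
- apply is_derive_Reals, Hl.
Qed.

Theorem theorem4p1 (c : R) (hc : c <> 0) :
  let s0 := 1 / 2 * (c ^ 2 + sqrt (c ^ 4 + 16)) in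
  exists (s d : R -> R) (eps : R),
    0 < eps <= 1 / 3 /\
    s 0 = s0 /\ d 0 = 0 /\
    (forall A : R, Rabs A < eps -> ex_derive s A /\ ex_derive d A) /\
    is_O_sq (fun A => s A - s0) /\
    is_O_sq (fun A => d A - Derive d 0 * A) /\
    forall A : R, 0 <= A < eps ->
      exists g : R -> phase,
        is_periodic_circular_orbit A c g /\
        (forall h : R -> phase, is_periodic_circular_orbit A c h -> same_orbit g h) /\
        (forall t : R,
           s_coord A (q_r (g t)) (q_x (g t)) = s A /\
           d_coord A (q_r (g t)) (q_x (g t)) = d A /\
           p_theta (g t) = c /\ p_r (g t) = 0 /\ p_x (g t) = 0).
Proof.
intro s0; destruct (s0_root c) as [H0 E0]; fold s0 in H0, E0; clearbody s0.
destruct (reduced_implicit_function c s0 hc H0 E0)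
  as [sigma [a [b [Ha [Hb [Hsig0 [Hbox Hsig]]]]]]].
destruct (circular_apriori c s0 hc H0 E0) as [K [a1 [HK [[Ha1 Ha13] Hap]]]].
assert (Hgt2 : forall A, Rabs A < a -> 2 < sigma A) by (intros A HA; apply Hbox, Hsig, HA).
set (d := fun A => A * slope A (sigma A)).
assert (Hslope : forall A, Rabs A < a -> ex_derive (fun B => slope B (sigma B)) A).
{ intros A HA; apply (ex_derive_comp_C1 _ _ _ _ C1_on_slope); [apply Hgt2, HA|].
  apply Hsig, HA. }
assert (Hd : forall A, Rabs A < a -> ex_derive d A).
{ intros A HA; unfold d; apply (ex_derive_mult (fun B => B)); [apply ex_derive_id|].
  apply Hslope, HA. }
assert (Z : Rabs 0 < a) by (rewrite Rabs_R0; exact Ha).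
assert (Hd0 : d 0 = 0) by (unfold d; ring).
destruct (Hd 0 Z) as [l Hl].
destruct (continuity_pt_eps d 0 2 (is_derive_continuity_pt _ _ _ Hl) ltac:(lra))
  as [a2 [Ha2 Hd2]].
assert (Hbk : 0 < b / (K + 1)) by (apply Rdiv_lt_0_compat; lra).
(* Here [a] is for the implicit function, [a1] for the a priori bounds, and [a2] for [|d A| < 2].
   The last radius gives [K * A^2 < b], placing every equilibrium in the uniqueness window of
   [sigma]. *)
set (eps := Rmin (Rmin a a1) (Rmin a2 (b / (K + 1)))).
assert (Heps : 0 < eps) by (apply Rmin_glb_lt; apply Rmin_glb_lt; assumption).
assert (Hlt : forall A, Rabs A < eps ->
  Rabs A < a /\ Rabs A < a1 /\ Rabs A < a2 /\ Rabs A < b / (K + 1)).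
{ intros A HA; unfold eps in HA.
  pose proof (Rmin_l (Rmin a a1) (Rmin a2 (b / (K + 1)))).
  pose proof (Rmin_r (Rmin a a1) (Rmin a2 (b / (K + 1)))).
  pose proof (Rmin_l a a1); pose proof (Rmin_r a a1).
  pose proof (Rmin_l a2 (b / (K + 1))); pose proof (Rmin_r a2 (b / (K + 1))).
  lra. }
assert (Heps3 : eps <= 1 / 3).
{ apply Rle_trans with a1; [|exact Ha13].
  unfold eps; eapply Rle_trans; [apply Rmin_l|apply Rmin_r]. }
assert (Hdsq : forall A, Rabs A < eps -> d A ^ 2 < 4).
{ intros A HA; destruct (Hlt A HA) as [_ [_ [HA2 _]]].
  assert (B := Hd2 A); rewrite Hd0, !Rminus_0_r in B; specialize (B HA2).
  apply Rabs_lt_between in B; nra. }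
assert (Heqs : forall A, Rabs A < eps ->
  radial_eq c A (sigma A) (d A) /\ axial_eq A (sigma A) (d A)).
{ intros A HA; destruct (Hlt A HA) as [HA1 _]; split.
  - apply reduced_radial_eq, Hsig, HA1.
  - apply axial_eq_slope, Hgt2, HA1. }
assert (Huniq : forall A s' d', Rabs A < eps -> 2 < s' -> d' ^ 2 < 4 ->
  radial_eq c A s' d' -> axial_eq A s' d' -> s' = sigma A /\ d' = d A).
{ intros A s' d' HA Hs' Hd' R1 R2.
  destruct (Hlt A HA) as [HA0 [HA1 [_ HA3]]].
  destruct (Hap A s' d' HA1 Hs' Hd' R1 R2) as [C1 C2].
  pose proof (axial_eq_inv A s' d' Hs' R2 C2) as D.
  assert (S : s' = sigma A).
  { apply (Hsig A HA0).
    - eapply Rle_lt_trans; [exact C1|].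
      assert (Rabs A * (K + 1) < b).
      { replace b with (b / (K + 1) * (K + 1)) by (field; lra).
        apply Rmult_lt_compat_r; lra. }
      rewrite <- (pow2_abs A); pose proof (Rabs_pos A).
      assert (Rabs A ^ 2 <= Rabs A) by nra.
      assert (K * Rabs A ^ 2 <= K * Rabs A) by (apply Rmult_le_compat_l; lra).
      lra.
    - apply reduced_radial_eq; rewrite <- D; exact R1. }
  split; [exact S|unfold d; rewrite <- S; exact D]. }
exists sigma, d, eps.
split; [split; assumption|]; split; [exact Hsig0|]; split; [exact Hd0|].
split.
{ intros A HA; destruct (Hlt A HA) as [HA1 _]; split; [apply Hsig, HA1|apply Hd, HA1]. }
split.
(* The a priori bound for arbitrary equilibria, applied to the branch itself, gives the quadratic
   estimate without a second derivative of [sigma]. *)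
{ exists K, eps; split; [exact Heps|intros A HA].
  destruct (Heqs A HA) as [R1 R2], (Hlt A HA) as [HA1 [HA2 _]].
  apply (Hap A (sigma A) (d A) HA2 (Hgt2 A HA1) (Hdsq A HA) R1 R2). }
split; [apply (is_O_sq_mul_id (fun A => slope A (sigma A))), Hslope, Z|].
intros A HA.
assert (HA' : Rabs A < eps) by (rewrite Rabs_pos_eq; lra).
destruct (Heqs A HA') as [R1 R2], (Hlt A HA') as [HA1 _].
destruct (position_of_coords A (sigma A) (d A) (Hgt2 A HA1) (Hdsq A HA'))
  as [Hr [Es Ed]].
set (r := sqrt _ / 4) in *; set (x := - A - _) in *.
exists (circular_orbit c r x); split; [|split].
- split; [|split; [|split]].
  + apply circular_orbit_solution; [exact Hr| |]; rewrite Es, Ed; assumption.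
  + intros t u; split; reflexivity.
  + apply circular_orbit_periodic; assumption.
  + reflexivity.
- intros h [Hsol [Hcirc [_ Hc]]].
  destruct (circular_solution_equations A c h Hsol Hcirc Hc) as [Hr' [T1 [T2 T3]]].
  destruct (coords_of_position A _ (q_x (h 0)) Hr') as [P1 [P2 P3]].
  destruct (Huniq A _ _ HA' (s_coord_gt2 A _ (q_x (h 0)) Hr') P2 T1 T2) as [U1 U2].
  rewrite U1, U2 in P1, P3.
  assert (Er : q_r (h 0) = r).
  { unfold r; rewrite <- P1.
    replace (16 * q_r (h 0) ^ 2) with ((4 * q_r (h 0)) * (4 * q_r (h 0))) by ring.
    rewrite sqrt_square by lra; field. }
  (* The constructed orbit starts at angle 0, so the shift is the initial angle of [h]. *)
  exists (q_theta (h 0)); intro t; simpl.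
  destruct (T3 t) as [V1 [V2 [V3 [V4 V5]]]].
  rewrite V1, V2, V3, V4, V5, Hc, Er.
  repeat split; [field; lra|exact P3].
- intro t; simpl; auto.
Qed.
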